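(* Let $\mathrm{Dis}$ be a bilinear disparity measure with weighting function $w_{\mathrm{Dis}}(x,a)=s_{\mathrm{Dis},a}\eta_a(x)+b_{\mathrm{Dis},a}$. Suppose that for $a\in\{0,1\}$ both $\eta_a(X)$ and $w_{\mathrm{Dis}}(X,a)$ have probability density functions when $X\sim\mathbb P_{X\mid A=a}$, the boundary sets $\{x:\eta_a(x)=\frac12+\frac t2w_{\mathrm{Dis}}(x,a)\}$, $t\in\mathbb R$, being of $\mathbb P_{X\mid A=a}$-measure zero. Let $H_{\mathrm{Dis},a}(t)=\frac{1+t\,b_{\mathrm{Dis},a}}{2-t\,s_{\mathrm{Dis},a}}$, $c_{a,y}(t)=(1-2y)H_{\mathrm{Dis},a}(t)+y$, and define the fair cost-sensitive risk $$R^{\mathrm{FCSC}}_t(f)=\sum_{a\in\{0,1\}}\sum_{y\in\{0,1\}}c_{a,y}(t)\,\mathbb P(\widehat Y_f=1-y,Y=y,A=a),\qquad f^{\mathrm{FCSC}}_t=\operatorname*{argmin}_{f\in\mathcal F}R^{\mathrm{FCSC}}_t(f).$$ Let $t_0^\star=t_{\mathrm{Dis}}(0)=\operatorname{argmin}_t\{|t|:|D_{\mathrm{Dis}}(t)|=0\}$. Then for $t\in[\min(t_0^\star,0),\max(t_0^\star,0)]$, $f^{\mathrm{FCSC}}_t$ is a $|D_{\mathrm{Dis}}(t)|$-fair Bayes-optimal classifier for $\mathbb P$. In particular, $f^{\mathrm{FCSC}}_{t_{\mathrm{Dis}}(\delta)}$ is a $\delta$-fair Bayes-optimal classifier for $\mathbb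 P$ (for any $\delta\ge0$).
   Context: Let $(X,A,Y)\sim\mathbb P$ be a random triple with values in $\mathcal X\times\{0,1\}\times\{0,1\}$, $p_a=\mathbb P(A=a)>0$, $\eta_a(x)=\mathbb P(Y=1\mid A=a,X=x)$, and $\mathbb P_{X\mid A=a}$ the conditional law of $X$ given $A=a$. $I(\cdot)$ is the indicator function. A (randomized) classifier is a measurable $f:\mathcal X\times\{0,1\}\to[0,1]$; $\mathcal F$ is the set of all of them. Its prediction satisfies $\widehat Y_f\mid X=x,A=a\sim\mathrm{Bernoulli}(f(x,a))$, conditionally independent of $Y$ given $(X,A)$. The misclassification error is $R(f)=\mathbb P(Y\ne\widehat Y_f)$. A disparity measure $\mathrm{Dis}:\mathcal F\to[-1,1]$ is bilinear if $\mathrm{Dis}(f)=\int f(x,a)\,w_{\mathrm{Dis}}(x,a)\,d\mathbb P_{X,A}(x,a)$ for all $f\in\mathcal F$, where $w_{\mathrm{Dis}}(x,a)=s_{\mathrm{Dis},a}\eta_a(x)+b_{\mathrm{Dis},a}$ with real numbers $s_{\mathrm{Dis},a},b_{\mathrm{Dis},a}$ depending only on $a$ (and $\mathbb P$). A $\delta$-fair Bayes-optimal classifier for $\mathbb P$ is any element of $\operatorname{argmin}_{f\in\mathcal F}\{R(f):|\mathrm{Dis}(f)|\le\delta\}$. For $t\in\mathbb R$, $f_{\mathrm{Dis},t}(x,a)=I\big(\eta_a(x)>\frac12+\frac t2w_{\mathrm{Dis}}(x,a)\big)$ and $D_{\mathrm{Dis}}(t)=\mathrm{Dis}(f_{\mathrm{Dis},t})$;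 for $\delta\ge0$, $t_{\mathrm{Dis}}(\delta)=\operatorname{argmin}_t\{|t|:|D_{\mathrm{Dis}}(t)|\le\delta\}$.
   Formalization: It is additionally assumed that 2 − t·s_{Dis,a} ≠ 0 for a∈{0,1} and all t in [min(t_0*,0), max(t_0*,0)], so that H_{Dis,a}(t) is defined on the whole range; without this the claim can fail at t = t_0*. *)

(* Defs.v *)
From HB Require Import structures.
From mathcomp Require Import all_boot all_order all_algebra.
From mathcomp Require Import all_classical all_reals all_analysis.
Import Order.TTheory GRing.Theory Num.Theory.
Import numFieldNormedType.Exports.

Set Implicit Arguments.
Unset Strict Implicit.
Unset Printing Implicit Defensive.

Local Open Scope classical_set_scope.
Local Open Scope ring_scope.

Definition is_argmin (R : realType) (T : Type) (S : set T) (g : T -> R) (x : T)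
    : Prop :=
  S x /\ forall y, S y -> g x <= g y.

Definition has_density (R : realType) (mu : set R -> \bar R) : Prop :=
  exists g : R -> R,
    [/\ measurable_fun setT g, (forall u, 0 <= g u) &
        forall B : set R, measurable B ->
          mu B = (\int[lebesgue_measure]_(u in B) (g u)%:E)%E].

Section RandomTriple.
Context d d' (R : realType) (Om : measurableType d) (TX : measurableType d').
Variables (P : probability Om R).
Variables (X : {RV P >-> TX}) (A Y : {RV P >-> bool}).

Definition XA (w : Om) : TX * bool := (X w, A w).

Definition law_XA : set (TX * bool) -> \bar R := pushforward P XA.

(* The law of X given A = a, when P(A = a) > 0. *)
Definition cond_law (a : bool) (B : set TX) : \bar R :=
  (fine (P (X @^-1` B `&` A @^-1` [set a])) / fine (P (A @^-1` [set a])))%:E.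

(* [eta a x] is a version of P(Y = 1 | A = a, X = x): these are the defining
   properties of the conditional probability of {Y = 1} given (X, A). *)
Definition is_regression (eta : bool -> TX -> R) : Prop :=
  [/\ (forall a, measurable_fun setT (eta a)),
      (forall a x, 0 <= eta a x <= 1) &
      forall C : set (TX * bool), measurable C ->
        P (XA @^-1` C `&` Y @^-1` [set true]) =
        (\int[law_XA]_(z in C) (eta z.2 z.1)%:E)%E].

Definition classifiers : set (TX * bool -> R) :=
  [set f : TX * bool -> R | measurable_fun setT f /\ forall z, 0 <= f z <= 1].

(* Probability of an event E that depends on the sample point w and on the
   prediction yhat.  Given w, yhat is drawn from Bernoulli(f(X w, A w)); this is
   the composition of P with that kernel, so yhat is conditionally independent
   of Y given (X, A). *)
Definition pred_prob (f : TX * bool -> R) (E : Om -> bool -> Prop) : R :=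
  fine (\int[P]_w bernoulli_prob (f (XA w)) [set yhat | E w yhat])%E.

Definition misclass (f : TX * bool -> R) : R :=
  pred_prob f (fun w yhat => Y w <> yhat).

Definition weight (eta : bool -> TX -> R) (s b : bool -> R) (z : TX * bool) : R :=
  s z.2 * eta z.2 z.1 + b z.2.

(* Dis is a function on [classifiers]; its values elsewhere are irrelevant. *)
Definition bilinear_disparity (eta : bool -> TX -> R) (s b : bool -> R)
    (Dis : (TX * bool -> R) -> R) : Prop :=
  forall f, classifiers f ->
    -1 <= Dis f <= 1 /\
    Dis f = fine (\int[law_XA]_z (f z * weight eta s b z)%:E)%E.

Definition fair_bayes_optimal (Dis : (TX * bool -> R) -> R) (delta : R)
    (f : TX * bool -> R) : Prop :=
  is_argmin [set g | classifiers g /\ `|Dis g| <= delta] misclass f.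

Definition threshold_clf (eta : bool -> TX -> R) (s b : bool -> R) (t : R)
    (z : TX * bool) : R :=
  (2^-1 + t / 2 * weight eta s b z < eta z.2 z.1)%R%:R.

Definition disp_at (eta : bool -> TX -> R) (s b : bool -> R)
    (Dis : (TX * bool -> R) -> R) (t : R) : R :=
  Dis (threshold_clf eta s b t).

Definition is_tDis (eta : bool -> TX -> R) (s b : bool -> R)
    (Dis : (TX * bool -> R) -> R) (delta t : R) : Prop :=
  is_argmin [set u | `|disp_at eta s b Dis u| <= delta] (fun u : R => `|u|) t.

Definition Hthr (s b : bool -> R) (a : bool) (t : R) : R :=
  (1 + t * b a) / (2 - t * s a).

Definition cost (s b : bool -> R) (a y : bool) (t : R) : R :=
  (1 - 2 * y%:R) * Hthr s b a t + y%:R.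

Definition fcsc_risk (s b : bool -> R) (t : R) (f : TX * bool -> R) : R :=
  \sum_(a : bool) \sum_(y : bool)
    cost s b a y t *
    pred_prob f (fun w yhat => [/\ yhat = ~~ y, Y w = y & A w = a]).

Definition is_fcsc (s b : bool -> R) (t : R) (f : TX * bool -> R) : Prop :=
  is_argmin classifiers (fcsc_risk s b t) f.

End RandomTriple.

(* Main.v *)
Require Import Defs.
From HB Require Import structures.
From mathcomp Require Import all_boot all_order all_algebra.
From mathcomp Require Import all_classical all_reals all_analysis.
From mathcomp Require Import measurable_realfun ring lra.
Import Order.TTheory GRing.Theory Num.Theory.
Import numFieldNormedType.Exports.

Set Implicit Arguments.
Unset Strict Implicit.
Unset Printing Implicit Defensive.

Local Open Scope classical_set_scope.
Local Open Scope ring_scope.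

(* Write c = 1 - 2 eta.  Up to an additive constant, R(f) = E[f c], and for
   2 - t s_a > 0 the cost-sensitive risk is E[f (c + t w) / (2 - t s_a)].
   Since the boundary {c + t w = 0} is null, every minimizer of the latter
   agrees a.e. with the threshold classifier f_t = 1{c + t w < 0}, which also
   minimizes the Lagrangian R + t Dis; hence f_t is optimal under
   |Dis| <= delta as soon as |t| delta <= t D(t).  Minimality of the Lagrangian
   at two parameters makes D antitone, so t D(t) = |t| |D(t)| between 0 and the
   root t0.  Dominated convergence makes D continuous, so that the constraint is
   active, D(t) = sgn(t) delta, when t <> 0 has minimal modulus among
   {|D| <= delta}. *)

(** * Integration against a measure given by a density *)

Section Density.
Context d (T : measurableType d) (R : realType).
Local Open Scope ereal_scope.

(** An integral over a [mu]-null set vanishes, so [nu] is absolutely continuous. Its Radon-Nikodym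
    derivative has the same integrals as [g] over all measurable sets, hence equals [g] almost
    everywhere. *)
Lemma integral_density (nu : {finite_measure set T -> \bar R})
    (mu : {sigma_finite_measure set T -> \bar R}) (g f : T -> \bar R) :
  mu.-integrable setT g ->
  (forall A, measurable A -> nu A = \int[mu]_(x in A) g x) ->
  nu.-integrable setT f ->
  \int[nu]_x f x = \int[mu]_x (f x * g x).
Proof.
move=> ig nuE intf.
have numu : nu `<< mu.
  apply/null_content_dominatesP => A mA muA0.
  rewrite nuE// null_set_integral//.
  exact: measurable_funS (measurable_int _ ig).
have mf := measurable_int _ intf.
rewrite -(Radon_Nikodym_change_of_variables numu)//.
have iRN :=
  @Radon_Nikodym_integrable _ T R (charge_of_finite_measure nu) mu numu.
have mRN := measurable_int _ iRN.
apply: ae_eq_integral => //.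
- exact: emeasurable_funM.
- exact: emeasurable_funM (measurable_int _ ig).
apply: ae_eqe_mul2l; apply: integral_ae_eq => //.
- exact: measurable_int ig.
- by move=> A _ mA; rewrite -Radon_Nikodym_integral//; exact: nuE.
Qed.

End Density.

(** * Bounded measurable functions *)

Section Bounded.
Context d (T : measurableType d) (R : realType).

(** Stable under arithmetic and integrable for every finite measure: this settles the integrability
    conditions for all combinations of classifiers, [eta] and weights below. *)
Definition bounded_mfun (h : T -> R) : Prop :=
  measurable_fun setT h /\ exists M, forall z, `|h z| <= M.

Lemma bounded_mfun_cst c : bounded_mfun (fun=> c).
Proof. by split; [exact: measurable_cst | exists `|c|]. Qed.

Lemma bounded_mfunD f g :
  bounded_mfun f -> bounded_mfun g -> bounded_mfun (fun z => f z + g z).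
Proof.
move=> [mf [M fM]] [mg [N gN]]; split; first exact: measurable_funD.
by exists (M + N) => z; rewrite (le_trans (ler_normD _ _))// lerD.
Qed.

Lemma bounded_mfunM f g :
  bounded_mfun f -> bounded_mfun g -> bounded_mfun (fun z => f z * g z).
Proof.
move=> [mf [M fM]] [mg [N gN]]; split; first exact: measurable_funM.
by exists (M * N) => z; rewrite normrM ler_pM.
Qed.

Lemma bounded_mfunB f g :
  bounded_mfun f -> bounded_mfun g -> bounded_mfun (fun z => f z - g z).
Proof.
move=> bf [mg [N gN]]; apply: bounded_mfunD => //; split.
  exact: measurableT_comp.
by exists N => z; rewrite normrN.
Qed.

Lemma bounded_mfun_unit (f : T -> R) :
  measurable_fun setT f -> (forall z, 0 <= f z <= 1) -> bounded_mfun f.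
Proof.
move=> mf f01; split=> //; exists 1 => z.
by have /andP[f0 f1] := f01 z; rewrite ger0_norm.
Qed.

Lemma bounded_mfun_integrable (mu : {finite_measure set T -> \bar R}) h :
  bounded_mfun h -> mu.-integrable setT (EFin \o h).
Proof.
move=> [mh [M hM]]; apply: measurable_bounded_integrable => //.
  by rewrite ltey_eq fin_num_measure.
exists M; split; first exact: num_real.
by move=> x Mx z _; exact: le_trans (hM z) (ltW Mx).
Qed.
End Bounded.

Lemma bounded_mfun_comp d d' (T : measurableType d) (T' : measurableType d')
    (R : realType) (phi : T -> T') (h : T' -> R) :
  measurable_fun setT phi -> bounded_mfun h -> bounded_mfun (h \o phi).
Proof.
move=> mphi [mh [M hM]]; split; first exact: measurableT_comp.
by exists M => z; exact: hM.
Qed.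

Lemma bounded_mfun_bool d (T : measurableType d) (R : realType) (B : T -> bool)
    (g : bool -> R) : measurable_fun setT B -> bounded_mfun (g \o B).
Proof.
move=> mB; split; first exact: measurableT_comp.
exists (`|g true| + `|g false|) => z /=.
by case: (B z); [rewrite lerDl | rewrite lerDr].
Qed.

(** * The Lagrangian, its minimizers and their disparity *)

Section Lagrangian.
Context d (T : measurableType d) (R : realType).
Variables (mu : {finite_measure set T -> \bar R}) (c w : T -> R).
Hypotheses (bc : bounded_mfun c) (bw : bounded_mfun w).

Let clf (f : T -> R) := measurable_fun setT f /\ forall z, 0 <= f z <= 1.

Definition lagrangian_clf (t : R) (z : T) : R := (c z + t * w z < 0)%R%:R.

Definition lagrangian_disp (t : R) : R := \int[mu]_z (lagrangian_clf t z * w z).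

Let lag t z := c z + t * w z.

Let bounded_lag t : bounded_mfun (lag t).
Proof.
apply: bounded_mfunD => //.
by apply: bounded_mfunM => //; exact: bounded_mfun_cst.
Qed.

Lemma lagrangian_clf_classifier t : clf (lagrangian_clf t).
Proof.
split; last first.
  by move=> z; rewrite /lagrangian_clf; case: ltP; rewrite ?ler01 ?lexx.
have [mlag _] := bounded_lag t.
apply: (measurableT_comp (f := fun b : bool => b%:R : R)) => //.
exact: measurable_fun_ltr.
Qed.

Let bounded_clf f : clf f -> bounded_mfun f.
Proof. by case; exact: bounded_mfun_unit. Qed.

Let bounded_lclf t := bounded_clf (lagrangian_clf_classifier t).

(** A product [u * v] with [u] in [0,1] is least at [u = 1] if [v < 0] and at [u = 0] otherwise. The
    positive factor [a] keeps the sign: [a = 1] serves the Lagrangian, [a = 1 / (2 - t s_a)] the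
    cost-sensitive risk. *)
Lemma lagrangian_clf_le t u a z : 0 <= u <= 1 -> 0 < a ->
  lagrangian_clf t z * (a * (c z + t * w z)) <= u * (a * (c z + t * w z)).
Proof.
move=> /andP[u0 u1] a0; rewrite /lagrangian_clf.
case: ltP => lz.
  by rewrite ler_nM2r// pmulr_rlt0.
by rewrite mul0r mulr_ge0// mulr_ge0// ltW.
Qed.

Lemma lagrangian_clf_min t f : clf f ->
  \int[mu]_z (lagrangian_clf t z * c z) + t * lagrangian_disp t <=
  \int[mu]_z (f z * c z) + t * \int[mu]_z (f z * w z).
Proof.
move=> cf; have bf := bounded_clf cf.
have E g : clf g -> \int[mu]_z (g z * c z) + t * \int[mu]_z (g z * w z) =
    \int[mu]_z (g z * (1 * (c z + t * w z))).
  move=> cg; have bg := bounded_clf cg.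
  rewrite -RintegralZl// -?RintegralD//.
  - by apply: eq_Rintegral => z _; ring.
  - exact/bounded_mfun_integrable/bounded_mfunM.
  - by apply/bounded_mfun_integrable/bounded_mfunM/bounded_mfunM => //;
      exact: bounded_mfun_cst.
  - exact/bounded_mfun_integrable/bounded_mfunM.
rewrite E ?(E _ (lagrangian_clf_classifier t))//.
have b1 : bounded_mfun (fun z => 1 * (c z + t * w z)).
  by apply: bounded_mfunM (bounded_lag t); exact: bounded_mfun_cst.
apply: le_Rintegral => //; try exact/bounded_mfun_integrable/bounded_mfunM.
by move=> z _; apply: lagrangian_clf_le => //; case: cf.
Qed.

Hypothesis null_boundary : forall t, mu [set z | c z + t * w z = 0] = 0.

(** The gap between the two integrands is pointwise nonnegative with integral at most 0, so it
    vanishes a.e.; off the null boundary this forces [f] to equal the threshold classifier. Taking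
    [h] to be [w] or [c] then transfers disparity or error. *)
Lemma weighted_minimizer_integral t (k f h : T -> R) :
  bounded_mfun k -> (forall z, 0 < k z) -> clf f -> bounded_mfun h ->
  \int[mu]_z (f z * (k z * (c z + t * w z))) <=
  \int[mu]_z (lagrangian_clf t z * (k z * (c z + t * w z))) ->
  \int[mu]_z (f z * h z) = \int[mu]_z (lagrangian_clf t z * h z).
Proof.
move=> bk k0 cf bh fmin; have bf := bounded_clf cf.
have bkl : bounded_mfun (fun z => k z * (c z + t * w z)).
  exact: bounded_mfunM (bounded_lag t).
pose gap z := f z * (k z * (c z + t * w z)) -
              lagrangian_clf t z * (k z * (c z + t * w z)).
have gap0 z : 0 <= gap z.
  by rewrite subr_ge0; apply: lagrangian_clf_le => //; case: cf.
have bgap : bounded_mfun gap by apply: bounded_mfunB; exact: bounded_mfunM.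
have igap : mu.-integrable setT (EFin \o gap) by exact: bounded_mfun_integrable.
have mgap := measurable_int _ igap.
have gapae : ae_eq mu setT (EFin \o gap) (cst 0%E).
  apply/ae_eq_integral_abs => //.
  under eq_integral => z _ do rewrite /= ger0_norm//.
  rewrite -[LHS]fineK; last exact: integrable_fin_num igap.
  congr EFin; apply/eqP; rewrite eq_le; apply/andP; split.
    rewrite -/(Rintegral mu setT gap) RintegralB//; first by rewrite subr_le0.
    - exact/bounded_mfun_integrable/bounded_mfunM.
    - exact/bounded_mfun_integrable/bounded_mfunM.
  exact: Rintegral_ge0.
have nullae : {ae mu, forall z, lag t z != 0}.
  have [mlag _] := bounded_lag t.
  exists (setT `&` lag t @^-1` [set 0]); split.
  - exact: mlag.
  - by rewrite setTI; exact: null_boundary.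
  - by move=> z /= /negP; rewrite negbK => /eqP.
congr fine; apply: ae_eq_integral => //.
- exact/measurable_int/bounded_mfun_integrable/bounded_mfunM.
- exact/measurable_int/bounded_mfun_integrable/bounded_mfunM.
move: gapae; apply: filterS2 nullae => z lz /(_ I) /= [] /eqP.
rewrite /gap -mulrBl mulf_eq0 mulf_eq0 (gt_eqF (k0 z)).
rewrite -[X in _ || X]/(lag t z == 0) (negbTE lz) !orbF.
by rewrite subr_eq0 => /eqP ->.
Qed.

(** Test minimality at [t] against the classifier of [u], and conversely. In the sum the integrals
    of [c] cancel, leaving (t - u)(D(t) - D(u)) <= 0. *)
Lemma lagrangian_disp_antitone :
  {homo lagrangian_disp : t u / t <= u >-> u <= t}.
Proof.
move=> t u; rewrite le_eqVlt => /predU1P[->//|tu].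
have := lagrangian_clf_min t (lagrangian_clf_classifier u).
have := lagrangian_clf_min u (lagrangian_clf_classifier t).
rewrite -/(lagrangian_disp t) -/(lagrangian_disp u).
by nra.
Qed.

(** Sequential continuity by dominated convergence, with a bound [M] of [w] as dominating
    constant. *)
Lemma lagrangian_disp_continuous : continuous lagrangian_disp.
Proof.
move=> t; apply/(@cvg_nbhsP _ R^o) => u ut.
have [mw [M wM]] := bw.
have bM v : bounded_mfun (fun z => lagrangian_clf v z * w z).
  exact: bounded_mfunM.
apply: fine_cvg; rewrite fineK; last first.
  by apply: integrable_fin_num => //; exact: bounded_mfun_integrable.
have := @dominated_convergence _ _ _ mu _ measurableT
   (fun n z => (lagrangian_clf (u n) z * w z)%:E)
   (fun z => (lagrangian_clf t z * w z)%:E) (cst M%:E).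
case=> //.
- by move=> n; exact/measurable_int/bounded_mfun_integrable.
- exact/measurable_int/bounded_mfun_integrable.
- have [mlag _] := bounded_lag t.
  exists (setT `&` lag t @^-1` [set 0]); split.
  - exact: mlag.
  - by rewrite setTI; exact: null_boundary.
  - move=> z /= /not_implyP[_]; apply: contra_notP => lz.
    have lu : lag (u n) z @[n --> \oo] --> lag t z.
      by apply: cvgD; [exact: cvg_cst | exact: cvgMr_tmp].
    (* Since [lag t z] is nonzero, [lag (u n) z] eventually has the same sign, so the indicator is
       eventually constant in [n]. *)
    apply: cvg_near_cst; rewrite /lagrangian_clf.
    have [l0|l0] := ltP (c z + t * w z) 0.
      have : \forall n \near \oo, lag (u n) z < 0 by apply: (cvgr_lt _ lu).
      by apply: filterS => n; rewrite /lag => ->.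
    have {}l0 : 0 < lag t z.
      by rewrite lt_neqAle eq_sym l0 andbT; apply/eqP => l; exact: lz.
    have : \forall n \near \oo, 0 < lag (u n) z by apply: (cvgr_gt _ lu).
    apply: filterS => n; rewrite /lag ltNge le_eqVlt negb_or.
    by move=> /andP[_ /negbTE ->].
- exact/finite_measure_integrable_cst.
- apply: aeW => z n _ /=; rewrite lee_fin normrM -[leRHS]mul1r ler_pM//.
  by rewrite /lagrangian_clf; case: (_ < _); rewrite ?normr1 ?normr0.
Unshelve. all: by end_near. Qed.

Lemma lagrangian_clf_constrained_min t delta f : clf f ->
  `|\int[mu]_z (f z * w z)| <= delta ->
  `|t| * delta <= t * lagrangian_disp t ->
  \int[mu]_z (lagrangian_clf t z * c z) <= \int[mu]_z (f z * c z).
Proof.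
move=> cf fd td; have := lagrangian_clf_min t cf.
set F := Rintegral mu setT (fun z => f z * w z) in fd *.
have : t * F <= `|t| * delta.
  by rewrite (le_trans (ler_norm _))// normrM ler_wpM2l.
lra.
Qed.

End Lagrangian.

(** * Antitone real functions with a root *)

(** Between 0 and the root, [t] and [D t] have the same sign (in the weak sense). This is the
    duality condition at level |D(t)|. *)
Lemma antitone_root_sign (R : realType) (D : R -> R) (t0 t : R) :
  {homo D : x y / x <= y >-> y <= x} -> D t0 = 0 ->
  Num.min t0 0 <= t <= Num.max t0 0 -> t * D t = `|t| * `|D t|.
Proof.
move=> Dle D0; rewrite ge_min le_max => /andP[lo hi].
have [tn|tp|->] := ltgtP t 0; last by rewrite normr0 !mul0r.
  move: lo; rewrite (leNgt 0) tn /= orbF => /Dle; rewrite D0 => Dt.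
  by rewrite !ler0_norm ?mulrNN// ltW.
move: hi; rewrite (leNgt t 0) tp /= orbF => /Dle; rewrite D0 => Dt.
by rewrite !ger0_norm// ltW.
Qed.

Lemma minimal_positive_level (R : realType) (D : R -> R) (t0 delta t : R) :
  {homo D : x y / x <= y >-> y <= x} -> continuous D -> D t0 = 0 ->
  `|D t| <= delta -> (forall u, `|D u| <= delta -> `|t| <= `|u|) -> 0 < t ->
  t <= t0 /\ D t = delta.
Proof.
move=> Dle Dc D0 Dt tmin t_gt0.
have tt0 : t <= t0.
  have : `|t| <= `|t0| by apply: tmin; rewrite D0 normr0 (le_trans _ Dt).
  rewrite (gtr0_norm t_gt0); have [t0p|t0n _] := leP 0 t0.
    by rewrite ger0_norm.
  (* A negative root would give D(t) <= D(0) <= 0, so 0 would be admissible, against minimality of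
     [t > 0]. *)
  have D00 : D 0 <= 0 by rewrite -[leRHS]D0; exact/Dle/ltW.
  suff /tmin : `|D 0| <= delta by rewrite normr0 gtr0_norm// (leNgt t 0) t_gt0.
  apply: le_trans Dt; have Dt0 := Dle _ _ (ltW t_gt0).
  by rewrite !ler0_norm ?lerN2// (le_trans Dt0).
split=> //; apply/eqP; rewrite eq_le (le_trans (ler_norm _) Dt)/= leNgt.
apply/negP => Dlt.
(* Were D(t) < delta, left continuity would give a smaller positive [u] with D(u) < delta; as u <
   t0, also D(u) >= 0, so [u] would be admissible. *)
have [u [u0 ut Du]] : exists u, [/\ 0 < u, u < t & D u < delta].
  near (at_left t) => u; exists u; split; near: u.
  - exact: nbhs_left_gt.
  - exact: nbhs_left_lt.
  - by apply: (cvgr_lt _ (cvg_at_left_filter (Dc t))).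
suff /tmin : `|D u| <= delta by rewrite !gtr0_norm// leNgt ut.
rewrite ger0_norm; first exact: ltW.
by rewrite -[leLHS]D0; apply: Dle; rewrite (le_trans (ltW ut)).
Unshelve. all: by end_near. Qed.

(** Places t_Dis(delta) in the range of the first claim and makes its constraint active, which
    yields the duality condition at level [delta]. *)
Lemma minimal_level (R : realType) (D : R -> R) (t0 delta t : R) :
  {homo D : x y / x <= y >-> y <= x} -> continuous D -> D t0 = 0 ->
  `|D t| <= delta -> (forall u, `|D u| <= delta -> `|t| <= `|u|) ->
  Num.min t0 0 <= t <= Num.max t0 0 /\ t * D t = `|t| * delta.
Proof.
move=> Dle Dc D0 Dt tmin; rewrite ge_min le_max.
have [tn|tp|->] := ltgtP t 0; last by rewrite normr0 !mul0r !orbT.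
(* The case t < 0 reduces to the positive one by the reflection x |-> - D(- x), whose root is -
   t0. *)
- have Dle' : {homo (fun x => - D (- x)) : x y / x <= y >-> y <= x}.
    by move=> x y xy; rewrite lerN2; apply: Dle; rewrite lerN2.
  have Dc' : continuous (fun x => - D (- x)).
    move=> x; apply: cvgN; apply: continuous_comp; last exact: Dc.
    exact: opp_continuous.
  have [||u||tt0 DE] := minimal_positive_level (t0 := - t0) (delta := delta)
      (t := - t) Dle' Dc'.
  + by rewrite opprK D0 oppr0.
  + by rewrite opprK normrN.
  + by rewrite !normrN => /tmin; rewrite normrN.
  + by rewrite oppr_gt0.
  rewrite lerN2 in tt0; rewrite opprK in DE.
  by rewrite tt0 orbT (ltr0_norm tn) -DE mulrNN.
- have [tt0 DE] := minimal_positive_level Dle Dc D0 Dt tmin tp.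
  by rewrite tt0 orbT (gtr0_norm tp) DE.
Qed.

(** * From the sample space to the law of (X, A) *)

Lemma integral_pushforward_density d d' (Om : measurableType d)
    (T : measurableType d') (R : realType)
    (Q : {finite_measure set Om -> \bar R})
    (mu : {sigma_finite_measure set T -> \bar R})
    (phi : Om -> T) (g f : T -> \bar R) :
  measurable_fun setT phi -> mu.-integrable setT g ->
  (forall A, measurable A -> Q (phi @^-1` A) = \int[mu]_(x in A) g x)%E ->
  measurable_fun setT f -> Q.-integrable setT (f \o phi) ->
  (\int[Q]_x f (phi x) = \int[mu]_x (f x * g x))%E.
Proof.
move=> mphi ig QE mf intf.
have fin_nu : fin_num_fun (pushforward Q phi).
  move=> A mA; apply: fin_num_measure.
  by rewrite -[X in measurable X]setTI; exact: mphi.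
pose nu0 : {measure set T -> \bar R} :=
  measure_function_pushforward__canonical__measure_function_Measure Q mphi.
pose nu : {finite_measure set T -> \bar R} :=
  HB.pack (pushforward Q phi) (Measure.class nu0)
    (Measure_isFinite.Build _ _ _ (Measure.sort nu0) fin_nu).
transitivity (\int[pushforward Q phi]_y f y)%E.
  by rewrite integral_pushforward.
apply: (integral_density (nu := nu mphi)) => //.
exact: integrable_pushforward.
Qed.

Section Transfer.
Context d d' (R : realType) (Om : measurableType d) (TX : measurableType d').
Variables (P : probability Om R) (X : {RV P >-> TX}) (A Y : {RV P >-> bool}).
Variables (eta : bool -> TX -> R).
Hypothesis heta : is_regression X A Y eta.

Let measurable_XA : measurable_fun setT (XA X A).
Proof. exact: measurable_fun_pair. Qed.

Let XA_rv : {RV P >-> (TX * bool)%type} :=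
  HB.pack (XA X A) (isMeasurableFun.Build _ _ _ _ _ measurable_XA).

(** [law_XA] bundled as a probability, so that results on finite measures apply to it. *)
Definition joint_law : probability (TX * bool)%type R := distribution P XA_rv.

Lemma bounded_regression : bounded_mfun (fun z : TX * bool => eta z.2 z.1).
Proof.
have [meta eta01 _] := heta.
apply: bounded_mfun_unit; last by move=> z; exact: eta01.
rewrite (_ : (fun z => _) =
    fun z => if z.2 then eta true z.1 else eta false z.1).
  exact: measurable_fun_if_pair.
by apply/funext => -[x []].
Qed.

Lemma Rintegral_joint_law h : bounded_mfun h ->
  \int[P]_w h (XA X A w) = \int[joint_law]_z h z.
Proof.
move=> bh; congr fine; have [mh _] := bh.
rewrite (@integral_distribution _ _ _ _ _ P XA_rv (EFin \o h))//.
- exact/measurable_EFinP.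
- exact/bounded_mfun_integrable/bounded_mfun_comp.
Qed.

Let mY : measurable (Y @^-1` [set true]).
Proof. by rewrite -[X in measurable X]setTI; exact: measurable_funPT. Qed.

Lemma Rintegral_regression h : bounded_mfun h ->
  \int[P]_w (h (XA X A w) * (Y w)%:R) =
  \int[joint_law]_z (h z * eta z.2 z.1).
Proof.
move=> bh; congr fine; have [mh _] := bh; have [_ _ etaE] := heta.
have PY : (P (Y @^-1` [set true]) < +oo)%E.
  by rewrite ltey_eq fin_num_measure.
(* Multiplying by Y amounts to integrating against P restricted to {Y = 1}. *)
transitivity (\int[mfrestr mY PY]_w (h (XA X A w))%:E)%E.
  rewrite (@integral_density _ _ _ (mfrestr mY PY) P
    (EFin \o \1_(Y @^-1` [set true])) (EFin \o h \o XA X A))//.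
  - apply: eq_integral => w _; rewrite /= -EFinM indicE; congr (_ * _%:R)%:E.
    by case E : (Y w); [rewrite mem_set | rewrite memNset//= E].
  - exact: integrable_indic.
  - by move=> C mC; rewrite integral_indic//= setIC.
  - exact/bounded_mfun_integrable/bounded_mfun_comp.
(* The defining property of [eta] says that this restricted measure, carried to the (X, A) space,
   has density [eta]. *)
have -> := @integral_pushforward_density _ _ _ _ _ (mfrestr mY PY) joint_law
  (XA X A) (fun z => (eta z.2 z.1)%:E) (EFin \o h).
- by [].
- by [].
- exact: (bounded_mfun_integrable _ bounded_regression).
- move=> C mC; rewrite /= /mfrestr /mrestr; exact: etaE.
- exact/measurable_EFinP.
- exact/bounded_mfun_integrable/bounded_mfun_comp.
Qed.

Lemma pred_probE f (E : Om -> bool -> Prop) : (forall z, 0 <= f z <= 1) ->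
  pred_prob X A f E =
  \int[P]_w (f (XA X A w) * `[< E w true >]%:R +
             (1 - f (XA X A w)) * `[< E w false >]%:R).
Proof.
move=> f01; congr fine; apply: eq_integral => w _.
by rewrite bernoulli_probE// !diracE EFinD !EFinM.
Qed.

(** Given the sample point, the error probability is Y + f (1 - 2 Y); in the term with f, Y may be
    replaced by [eta]. The other term does not depend on f. *)
Lemma misclassE f : classifiers f ->
  misclass X A Y f =
  \int[P]_w (Y w)%:R + \int[joint_law]_z (f z * (1 - 2 * eta z.2 z.1)).
Proof.
move=> [mf f01]; have bf : bounded_mfun f by exact: bounded_mfun_unit.
have breg := bounded_regression.
have bfX : bounded_mfun (f \o XA X A) by exact: bounded_mfun_comp.
have bY : bounded_mfun (fun w => (Y w)%:R : R).
  exact: (bounded_mfun_bool (fun y => y%:R)).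
have b2 : bounded_mfun (fun z => f z * eta z.2 z.1) by exact: bounded_mfunM.
have b2Y : bounded_mfun (fun w => f (XA X A w) * (Y w)%:R).
  exact: (bounded_mfunM bfX).
have -> : \int[joint_law]_z (f z * (1 - 2 * eta z.2 z.1)) =
    \int[P]_w (f (XA X A w)) - 2 * \int[P]_w (f (XA X A w) * (Y w)%:R).
  rewrite Rintegral_regression// Rintegral_joint_law//.
  rewrite -RintegralZl//; last first.
    exact: bounded_mfun_integrable.
  rewrite -RintegralB//; last 2 first.
  - exact: bounded_mfun_integrable.
  - apply: bounded_mfun_integrable; apply: bounded_mfunM b2.
    exact: bounded_mfun_cst.
  by apply: eq_Rintegral => z _; ring.
have b2Y2 : bounded_mfun (fun w => 2 * (f (XA X A w) * (Y w)%:R)).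
  by apply: bounded_mfunM b2Y; exact: bounded_mfun_cst.
rewrite -RintegralZl//; last exact: bounded_mfun_integrable.
rewrite -RintegralB//; try exact: bounded_mfun_integrable.
rewrite -RintegralD//; last 2 first.
- exact: bounded_mfun_integrable.
- by apply: bounded_mfun_integrable; exact: (bounded_mfunB bfX).
rewrite /misclass pred_probE//; apply: eq_Rintegral => w _.
have asboolE y : `[< Y w <> y >] = (Y w != y).
  by apply/asboolP/negP => [yY /eqP|/negP/eqP].
by rewrite !asboolE; case: (Y w) => /=; ring.
Qed.

(** The cell fixes the prediction to [~~ y], so only one of the two Bernoulli masses survives. *)
Lemma pred_prob_cell f (a y : bool) : (forall z, 0 <= f z <= 1) ->
  pred_prob X A f (fun w yhat => [/\ yhat = ~~ y, Y w = y & A w = a]) =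
  \int[P]_w ((if y then 1 - f (XA X A w) else f (XA X A w)) *
             ((Y w == y)%:R * (A w == a)%:R)).
Proof.
move=> f01; rewrite pred_probE//; apply: eq_Rintegral => w _.
have asboolE y' : `[< [/\ y' = ~~ y, Y w = y & A w = a] >] =
    [&& y' == ~~ y, Y w == y & A w == a].
  by apply/asboolP/and3P => [[/eqP ? /eqP ? /eqP ?] | [/eqP ? /eqP ? /eqP ?]].
rewrite !asboolE; case: y {asboolE} => /=; case: (_ == _) => /=;
  case: (_ == _) => /=; ring.
Qed.

(** The costs are 1 - H for y = 1 and H for y = 0, so the conditional cost is (1 - H)(1 - f) or H f,
    that is (1 - H) Y + f (H - Y) in both cases; then Y becomes [eta] next to f. *)
Lemma fcsc_riskE s b t f : classifiers f ->
  fcsc_risk X A Y s b t f =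
  \int[P]_w ((1 - Hthr s b (A w) t) * (Y w)%:R) +
  \int[joint_law]_z (f z * (Hthr s b z.2 t - eta z.2 z.1)).
Proof.
move=> [mf f01]; have bf : bounded_mfun f by exact: bounded_mfun_unit.
have breg := bounded_regression.
have bfX : bounded_mfun (f \o XA X A) by exact: bounded_mfun_comp.
have bY : bounded_mfun (fun w => (Y w)%:R : R).
  exact: (bounded_mfun_bool (fun y => y%:R)).
have b2 : bounded_mfun (fun z => f z * eta z.2 z.1) by exact: bounded_mfunM.
have bH : bounded_mfun (fun z : TX * bool => Hthr s b z.2 t).
  by apply: (bounded_mfun_bool (fun a => Hthr s b a t)); exact: measurable_snd.
have bfH : bounded_mfun (fun z => f z * Hthr s b z.2 t) by exact: bounded_mfunM.
have bHP : bounded_mfun (fun w => Hthr s b (A w) t).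
  exact: (bounded_mfun_bool (fun a => Hthr s b a t)).
have b2Y : bounded_mfun (fun w => f (XA X A w) * (Y w)%:R).
  exact: (bounded_mfunM bfX).
have bfHP : bounded_mfun (fun w => f (XA X A w) * Hthr s b (A w) t).
  exact: (bounded_mfunM bfX).
have b1HY : bounded_mfun (fun w => (1 - Hthr s b (A w) t) * (Y w)%:R).
  apply: bounded_mfunM => //; apply: bounded_mfunB => //.
  exact: bounded_mfun_cst.
have -> : \int[joint_law]_z (f z * (Hthr s b z.2 t - eta z.2 z.1)) =
    \int[P]_w (f (XA X A w) * Hthr s b (A w) t) -
    \int[P]_w (f (XA X A w) * (Y w)%:R).
  rewrite Rintegral_regression// (Rintegral_joint_law bfH) -RintegralB//.
  - by apply: eq_Rintegral => z _; ring.
  - exact: bounded_mfun_integrable.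
  - exact: bounded_mfun_integrable.
have bcell a y : bounded_mfun (fun w =>
    (if y then 1 - f (XA X A w) else f (XA X A w)) *
    ((Y w == y)%:R * (A w == a)%:R) : R).
  apply: bounded_mfunM; last apply: bounded_mfunM.
  - case: y => //; apply: bounded_mfunB => //; exact: bounded_mfun_cst.
  - exact: (bounded_mfun_bool (fun y' => (y' == y)%:R)).
  - exact: (bounded_mfun_bool (fun a' => (a' == a)%:R)).
have bcell1 a := bcell a true; have bcell0 a := bcell a false.
have bZ k g : bounded_mfun g -> bounded_mfun (fun w : Om => k * g w).
  by apply: bounded_mfunM; exact: bounded_mfun_cst.
have sum2 (F : bool -> R) : \sum_(i : bool) F i = F true + F false.
  exact: big_bool.
rewrite /fcsc_risk !sum2 !pred_prob_cell//=.
rewrite -!RintegralZl//; try exact: bounded_mfun_integrable.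
rewrite -!RintegralD//; try exact/bounded_mfun_integrable/bZ;
  try by apply/bounded_mfun_integrable/bounded_mfunD; exact: bZ.
rewrite -RintegralB//; try exact: bounded_mfun_integrable.
rewrite -RintegralD//; last 2 first.
- exact: bounded_mfun_integrable.
- by apply: bounded_mfun_integrable; exact: bounded_mfunB.
apply: eq_Rintegral => w _; rewrite /cost.
by case: (Y w); case: (A w) => /=; ring.
Qed.

End Transfer.

(** * Threshold form of the classifier and sign of the denominator *)

Lemma threshold_clfE d (R : realType) (TX : measurableType d)
    (eta : bool -> TX -> R) (s b : bool -> R) (t : R) :
  threshold_clf eta s b t =
  lagrangian_clf (fun z => 1 - 2 * eta z.2 z.1) (weight eta s b) t.
Proof.
apply/funext => z; rewrite /threshold_clf /lagrangian_clf.
congr (nat_of_bool _)%:R.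
by apply/idP/idP; lra.
Qed.

(** The affine map u |-> 2 - u s is 2 at 0, a point of the range, and has no zero there, so it stays
    positive. *)
Lemma denominator_gt0 (R : realType) (s t0 t : R) :
  (forall u, Num.min t0 0 <= u <= Num.max t0 0 -> 2 - u * s != 0) ->
  Num.min t0 0 <= t <= Num.max t0 0 -> 0 < 2 - t * s.
Proof.
move=> H tt; rewrite ltNge; apply/negP => ts.
have s0 : s != 0 by apply/eqP => s0; move: ts; rewrite s0; lra.
(* 2 / s is the zero of the affine map; if 2 - t s <= 0 it lies between 0 and [t], hence in the
   range. *)
have := H (2 / s); rewrite divfK// subrr eqxx => Hs.
suff /Hs : Num.min t0 0 <= 2 / s <= Num.max t0 0 by [].
have {ts}[[s_gt0 st]|[s_lt0 st]] :
    (0 < s /\ 2 / s <= t) \/ (s < 0 /\ t <= 2 / s).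
  case: (ltgtP s 0) s0 => // ss _; [right|left]; split=> //.
    by rewrite ler_ndivlMr//; lra.
  by rewrite ler_pdivrMr//; lra.
- have s2 : 0 <= 2 / s by rewrite divr_ge0// ltW.
  case/andP: tt => _ tt; rewrite (le_trans st tt) andbT.
  by rewrite (le_trans _ s2)// ge_min lexx orbT.
- have s2 : 2 / s <= 0 by rewrite mulr_ge0_le0// invr_le0 ltW.
  case/andP: tt => tt _; rewrite (le_trans tt st)/=.
  by rewrite (le_trans s2)// le_max lexx orbT.
Qed.

(** * Fair Bayes optimality of cost-sensitive minimizers *)

Section FairBayes.
Context d d' (R : realType) (Om : measurableType d) (TX : measurableType d').
Variables (P : probability Om R) (X : {RV P >-> TX}) (A Y : {RV P >-> bool}).
Variables (eta : bool -> TX -> R) (s b : bool -> R).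
Variable (Dis : (TX * bool -> R) -> R).
Hypothesis hA : forall a : bool, (0 < P (A @^-1` [set a]))%E.
Hypothesis heta : is_regression X A Y eta.
Hypothesis hDis : bilinear_disparity X A eta s b Dis.
Hypothesis hboundary : forall (a : bool) (t : R),
  cond_law X A a
    [set x | eta a x = 2^-1 + t / 2 * weight eta s b (x, a)] = 0%E.

Let c (z : TX * bool) : R := 1 - 2 * eta z.2 z.1.
Let w := weight eta s b.
Let mu := joint_law X A.

Let bounded_c : bounded_mfun c.
Proof.
apply: bounded_mfunB; first exact: bounded_mfun_cst.
by apply: bounded_mfunM (bounded_regression heta); exact: bounded_mfun_cst.
Qed.

Let bounded_label (g : bool -> R) : bounded_mfun (fun z : TX * bool => g z.2).
Proof. by apply: (bounded_mfun_bool g); exact: measurable_snd. Qed.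

Let bounded_w : bounded_mfun w.
Proof.
apply: bounded_mfunD; last exact: (bounded_label b).
apply: bounded_mfunM (bounded_regression heta); exact: (bounded_label s).
Qed.

(** Split by label: each slice has mass P(A = a) times a conditional mass, and P(A = a) > 0 turns
    the vanishing of [cond_law] into that of the joint law. *)
Lemma boundary_null t : mu [set z | c z + t * w z = 0] = 0.
Proof.
pose N a := [set z | c z + t * w z = 0] `&` (snd @^-1` [set a]).
have mN a : measurable (N a).
  apply: measurableI.
    have [mlag _] : bounded_mfun (fun z => c z + t * w z).
      apply: bounded_mfunD => //; apply: bounded_mfunM => //.
      exact: bounded_mfun_cst.
    by rewrite -[X in measurable X]setTI; exact: (mlag measurableT [set 0]).
  rewrite -[X in measurable X]setTI.
  exact: (@measurable_snd _ _ TX bool measurableT [set a]).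
have N0 a : mu (N a) = 0%E.
  have := hboundary a t; rewrite /cond_law => -[/eqP].
  have pA : fine (P (A @^-1` [set a])) != 0.
    rewrite gt_eqF// fine_gt0// hA/= ltey_eq fin_num_measure//.
    by rewrite -[X in measurable X]setTI; exact: measurable_funPT.
  rewrite mulf_eq0 invr_eq0 (negbTE pA) orbF => /eqP NE.
  rewrite -[LHS]fineK ?fin_num_measure//; congr EFin.
  rewrite -[RHS]NE; congr (fine (P _)); apply/seteqP; split=> o /=.
    move=> [/= + Aa]; rewrite /c /w /XA /= Aa => E; split=> //; lra.
  by move=> [E Aa]; split=> //=; rewrite /c /w /XA /= Aa; lra.
suff -> : [set z | c z + t * w z = 0] = N true `|` N false.
  by apply: null_set_setU => //; exact: N0.
apply/seteqP; split=> z; last by case=> -[].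
by move=> z0; case E : z.2; [left|right].
Qed.

Lemma disE f : classifiers f -> Dis f = \int[mu]_z (f z * w z).
Proof. by case/hDis. Qed.

Lemma threshold_classifier t : classifiers (threshold_clf eta s b t).
Proof. by rewrite threshold_clfE; exact: lagrangian_clf_classifier. Qed.

Lemma disp_atE : disp_at eta s b Dis = lagrangian_disp mu c w.
Proof.
apply/funext => t; rewrite /disp_at disE ?threshold_clfE//.
by rewrite -threshold_clfE; exact: threshold_classifier.
Qed.

(* H_a(t) - eta = (1 - 2 eta + t w) / (2 - t s_a) *)
Lemma fcsc_eq_threshold t f (h : TX * bool -> R) :
  (forall a, 0 < 2 - t * s a) -> is_fcsc X A Y s b t f -> bounded_mfun h ->
  \int[mu]_z (f z * h z) = \int[mu]_z (threshold_clf eta s b t z * h z).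
Proof.
move=> s0 [cf fmin] bh; rewrite threshold_clfE.
apply: (weighted_minimizer_integral bounded_c bounded_w boundary_null
  (k := fun z => (2 - t * s z.2)^-1)) => //.
- exact: (bounded_label (fun a => (2 - t * s a)^-1)).
- by move=> z; rewrite invr_gt0.
have kE g : \int[mu]_z (g z * ((2 - t * s z.2)^-1 * (c z + t * w z))) =
    \int[mu]_z (g z * (Hthr s b z.2 t - eta z.2 z.1)).
  apply: eq_Rintegral => z _; rewrite /c /w /Hthr /weight; field.
  by rewrite gt_eqF.
(* Minimality is tested against the threshold classifier; the part of the risk that does not depend
   on the classifier cancels. *)
have := fmin _ (threshold_classifier t).
rewrite !(fcsc_riskE heta)// ?lerD2l ?kE -?threshold_clfE//.
exact: threshold_classifier.
Qed.

(** A minimizer [f] need not be the threshold classifier itself, but has the same integrals against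
    [w] and [c], hence the same disparity and error; weak duality then applies. *)
Lemma fcsc_fair_bayes_optimal t delta f :
  (forall a, 0 < 2 - t * s a) -> is_fcsc X A Y s b t f ->
  `|disp_at eta s b Dis t| <= delta ->
  `|t| * delta <= t * disp_at eta s b Dis t ->
  fair_bayes_optimal X A Y Dis delta f.
Proof.
move=> s0 ff Dt tD; have [cf _] := ff; split=> [|g [cg gd]].
  split=> //; rewrite disE// (fcsc_eq_threshold s0 ff bounded_w).
  by rewrite -disE//; exact: threshold_classifier.
rewrite !(misclassE heta)// lerD2l (fcsc_eq_threshold s0 ff bounded_c).
rewrite threshold_clfE disp_atE in tD *.
by apply: lagrangian_clf_constrained_min tD; rewrite // -disE.
Qed.

Lemma disp_at_antitone :
  {homo disp_at eta s b Dis : t u / t <= u >-> u <= t}.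
Proof. rewrite disp_atE; exact: lagrangian_disp_antitone. Qed.

Lemma disp_at_continuous : continuous (disp_at eta s b Dis).
Proof.
rewrite disp_atE; apply: lagrangian_disp_continuous => //; exact: boundary_null.
Qed.

End FairBayes.

Theorem theorem5p3 (d d' : measure_display) (R : realType)
    (Om : measurableType d) (TX : measurableType d') (P : probability Om R)
    (X : {RV P >-> TX}) (A Y : {RV P >-> bool})
    (eta : bool -> TX -> R) (s b : bool -> R)
    (Dis : (TX * bool -> R) -> R) (t0 : R)
    (hA : forall a : bool, (0 < P (A @^-1` [set a]))%E)
    (heta : is_regression X A Y eta)
    (hDis : bilinear_disparity X A eta s b Dis)
    (hdens_eta : forall a : bool,
      has_density (pushforward (cond_law X A a) (eta a)))
    (hdens_w : forall a : bool,
      has_density (pushforward (cond_law X A a)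
                     (fun x => weight eta s b (x, a))))
    (hboundary : forall (a : bool) (t : R),
      cond_law X A a
        [set x | eta a x = 2^-1 + t / 2 * weight eta s b (x, a)] = 0%E)
    (ht0 : is_tDis eta s b Dis 0 t0)
    (* H_a(t) is a quotient by 2 - t s_a: it has to be defined on the range *)
    (hH : forall (a : bool) (t : R),
      Num.min t0 0 <= t <= Num.max t0 0 -> 2 - t * s a != 0) :
  (forall t : R, Num.min t0 0 <= t <= Num.max t0 0 ->
     forall f : TX * bool -> R, is_fcsc X A Y s b t f ->
       fair_bayes_optimal X A Y Dis `|disp_at eta s b Dis t| f) /\
  (forall delta : R, 0 <= delta ->
     forall t : R, is_tDis eta s b Dis delta t ->
     forall f : TX * bool -> R, is_fcsc X A Y s b t f ->
       fair_bayes_optimal X A Y Dis delta f).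
Proof.
have D0 : disp_at eta s b Dis t0 = 0.
  by apply/eqP; rewrite -normr_le0; case: ht0.
have Dle := disp_at_antitone heta hDis.
have Dc := disp_at_continuous hA heta hDis hboundary.
have s0 t : Num.min t0 0 <= t <= Num.max t0 0 -> forall a, 0 < 2 - t * s a.
  by move=> tt a; apply: denominator_gt0 tt => u; exact: hH.
split=> [t tt f ff|delta _ t [Dt tmin] f ff].
  apply: (fcsc_fair_bayes_optimal hA heta hDis hboundary (s0 _ tt) ff) => //.
  by rewrite -(antitone_root_sign Dle D0 tt).
(* [tt] supplies positive denominators and [tD] the duality condition, with equality. *)
have [tt tD] := minimal_level Dle Dc D0 Dt tmin.
by apply: (fcsc_fair_bayes_optimal hA heta hDis hboundary (s0 _ tt) ff);
  rewrite ?tD.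
Qed.
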